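(* A metric space $(X,d)$ is Samuel realcompact (that is, $X=H(U_d(X))$) if and only if it is Bourbaki-complete and every uniformly discrete subspace of $X$ has non-measurable cardinal.
   Context: Let $(X,d)$ be a metric space. $U_d(X)$ is the unital vector lattice of all real-valued uniformly continuous functions on $X$, and $U_d^*(X)$ its subset of bounded functions. A compactification (resp. realcompactification) of $X$ is a compact Hausdorff (resp. realcompact Tychonoff) space containing $X$ as a dense subspace. The Samuel compactification $s_dX$ is the smallest compactification of $X$ to which every $f\in U_d^*(X)$ extends continuously, where $\alpha_1X\le\alpha_2X$ means that there is a continuous map $\alpha_2X\to\alpha_1X$ leaving $X$ pointwise fixed. Every $f\in U_d(X)$ has a unique continuous extension $f^*:s_dX\to\mathbb{R}\cup\{\infty\}$, the target being the one-point compactification of $\mathbb{R}$. The Samuel realcompactification of $X$ is $H(U_d(X))$, the space of unital vector lattice homomorphisms $U_d(X)\to\mathbb{R}$ with the topology of pointwise convergence ($X$ embedded via evaluations); it is identified with the subspace $H(U_d(X))=\{\xi\in s_dX: f^*(\xi)\neq\infty\text{ for all }f\in U_d(X)\}$ of $s_dX$. $X$ is Samuel realcompact if $X=H(U_d(X))$. For $x_0\in X$, $\varepsilon>0$ let $B_d^1(x_0,\varepsilon)=B_d(x_0,\varepsilon)$ be the open ball and, for $m\ge2$, $B_d^m(x_0,\varepsilon)=\bigcup\{B_d(x,\varepsilon):x\in B_d^{m-1}(x_0,\varepsilon)\}$. A net $(x_\lambda)_{\lambda\in\Lambda}$ in $X$ is Bourbaki-Cauchy if for every $\varepsilon>0$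 there exist $m\in\mathbb{N}$, $\lambda_0\in\Lambda$ and $x_0\in X$ such that $x_\lambda\in B_d^m(x_0,\varepsilon)$ for all $\lambda\ge\lambda_0$. $X$ is Bourbaki-complete if every Bourbaki-Cauchy net has a cluster point in $X$. A metric space $(Y,d)$ is uniformly discrete if there is $\varepsilon>0$ with $d(x,y)>\varepsilon$ for all $x\ne y$ in $Y$. A cardinal is measurable if a set of that cardinality carries a nonzero countably additive $\{0,1\}$-valued measure on all its subsets that vanishes on singletons; otherwise it is non-measurable. *)

(* Defs.v *)
From HB Require Import structures.
From mathcomp Require Import all_boot all_order all_algebra.
From mathcomp Require Import all_classical all_reals all_analysis.
From mathcomp Require Import lra.
Set Implicit Arguments.
Unset Strict Implicit.
Unset Printing Implicit Defensive.
Import Order.TTheory GRing.Theory Num.Theory.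
Import numFieldNormedType.Exports.
Local Open Scope classical_set_scope.
Local Open Scope ring_scope.

Section UniformlyContinuousFunctions.
Variables (R : realType) (X : metricType R).

Definition ucont : {pred X -> R} := [pred f : X -> R | `[< unif_continuous f >]].

Lemma ucontP (f : X -> R) : f \in ucont <->
  forall e : R, 0 < e -> exists2 d : R, 0 < d &
    forall x y, mdist x y < d -> `|f x - f y| < e.
Proof.
rewrite unfold_in /= asboolE; split=> [uf e e0|H E].
  have eE : entourage [set xy : R * R | ball xy.1 e xy.2].
    by rewrite -entourage_ballE; exists e.
  have : entourage [set xy : X * X | ball (f xy.1) e (f xy.2)] by exact: uf eE.
  rewrite -entourage_ballE => -[d d0 dE]; exists d => // x y xy.
  by have := dE (x, y); rewrite /= ballEmdist; apply.
rewrite -entourage_ballE => -[e e0 eE].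
have [d d0 dE] := H _ e0.
suff : entourage [set xy : X * X | E (f xy.1, f xy.2)] by [].
rewrite -entourage_ballE; exists d => // -[x y] /=; rewrite ballEmdist => xy.
exact/eE/dE.
Qed.

Fact ucont_submod : submod_closed ucont.
Proof.
split=> [|a f g /ucontP uf /ucontP ug]; apply/ucontP => e e0.
  by exists 1 => // x y _; rewrite subrr normr0.
have c0 : 0 < `|a| + 1 by rewrite ltr_wpDl.
have [d d0 fd] := uf (e / 2 / (`|a| + 1)) ltac:(by rewrite !divr_gt0).
have [d' d'0 gd] := ug (e / 2) ltac:(by rewrite divr_gt0).
exists (Num.min d d') => [|x y]; first by rewrite lt_min d0.
rewrite lt_min => /andP[/fd xf /gd xg].
have -> : (a *: f + g) x - (a *: f + g) y = a * (f x - f y) + (g x - g y).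
  rewrite !fctE /GRing.scale /= mulrBr opprD addrACA.
  by [].
rewrite (le_lt_trans (ler_normD _ _))// [ltRHS](splitr e) ler_ltD// normrM.
rewrite ltr_pdivlMr// in xf.
by rewrite (le_trans _ (ltW xf))// mulrC ler_wpM2l// lerDl.
Qed.

HB.instance Definition _ := GRing.isSubmodClosed.Build R (X -> R) ucont
  ucont_submod.

Fact ucont_meet : {in ucont &, forall f g, Order.meet f g \in ucont}.
Proof.
move=> f g /ucontP uf /ucontP ug; apply/ucontP => e e0.
have [d d0 fd] := uf _ e0; have [d' d'0 gd] := ug _ e0.
exists (Num.min d d') => [|x y]; first by rewrite lt_min d0.
rewrite lt_min => /andP[/fd + /gd]; rewrite !meetfE !meetEtotal /=.
rewrite !ltr_norml /Order.min.
by case: (ltP (f x)); case: (ltP (f y)) => ? ? /andP[? ?] /andP[? ?];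
  apply/andP; split; lra.
Qed.

Fact ucont_join : {in ucont &, forall f g, Order.join f g \in ucont}.
Proof.
move=> f g /ucontP uf /ucontP ug; apply/ucontP => e e0.
have [d d0 fd] := uf _ e0; have [d' d'0 gd] := ug _ e0.
exists (Num.min d d') => [|x y]; first by rewrite lt_min d0.
rewrite lt_min => /andP[/fd + /gd]; rewrite !joinfE !joinEtotal /=.
rewrite !ltr_norml /Order.max.
by case: (ltP (f x)); case: (ltP (f y)) => ? ? /andP[? ?] /andP[? ?];
  apply/andP; split; lra.
Qed.

HB.instance Definition _ := Order.isLatticeClosed.Build _ (X -> R) ucont
  ucont_meet ucont_join.

(* The lattice [U_d(X)]: module operations, order, meets and joins are all
   inherited from the pointwise ones on [X -> R]. *)
Record U_d := UFun { U_val :> X -> R ; _ : U_val \in ucont }.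

HB.instance Definition _ := [isSub for U_val].
HB.instance Definition _ := [Choice of U_d by <:].
HB.instance Definition _ := [SubChoice_isSubLmodule of U_d by <:].
HB.instance Definition _ := [SubChoice_isSubLattice of U_d by <:
  with FunOrder.fun_display].

Fact ucont_one : cst 1 \in ucont.
Proof. by apply/ucontP => e e0; exists 1 => // x y _; rewrite subrr normr0. Qed.

Definition U_one : U_d := UFun ucont_one.

Definition unital_vlattice_hom (phi : U_d -> R) : Prop :=
  [/\ scalar phi,
      {morph phi : f g / Order.meet f g},
      {morph phi : f g / Order.join f g} &
      phi U_one = 1].

(* [H(U_d(X))], a subspace of the product [R ^ U_d(X)]. *)
Definition samuel_realcompactification : set {ptws U_d -> R} :=
  [set phi | unital_vlattice_hom phi].

Definition evaluation (x : X) : {ptws U_d -> R} := fun f => f x.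

(* [X] embeds topologically in [H(U_d(X))] through [evaluation] (see below), so
   that [X = H(U_d(X))] means that the embedding is onto. *)
Definition samuel_realcompact : Prop :=
  range evaluation = samuel_realcompactification.

Lemma evaluation_hom x : samuel_realcompactification (evaluation x).
Proof. by split. Qed.

Fact ucont_mdist (a : X) : mdist a \in ucont.
Proof.
apply/ucontP => e e0; exists e => // x y xy; apply: le_lt_trans xy.
have := metric_triangle a x y; have := metric_triangle a y x.
by rewrite (metric_sym y x) ler_norml => *; apply/andP; split; lra.
Qed.

Lemma evaluation_inj : injective evaluation.
Proof.
move=> x y /(congr1 (fun phi : U_d -> R => phi (UFun (ucont_mdist x)))).
by rewrite /evaluation /= mdistxx => /esym/mdist_positivity.
Qed.

Lemma evaluation_embedding (x : X) (A : set X) :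
  nbhs x A <-> exists2 V, nbhs (evaluation x) V & evaluation @^-1` V `<=` A.
Proof.
split=> [|[V + VA]].
  rewrite -(@metricType_numDomainType.filter_from_mdist_nbhs R X).
  move=> [e /= e0 eA].
  pose f := UFun (ucont_mdist x).
  exists [set phi : {ptws U_d -> R} | phi f < e].
    apply: (@proj_continuous U_d (fun=> R) f (evaluation x) [set r | r < e]).
    rewrite /proj /evaluation /= mdistxx; exact: lt_nbhsl.
  by move=> y; rewrite /evaluation /= => /eA.
suff evx : evaluation x @[x --> x] --> evaluation x.
  by move=> /evx h; exact: filterS VA h.
apply/cvg_sup => f B [C [[W oW <-] Wfx] CB].
have /ucontP uf := valP f.
have [e /= e0 eW] : nbhs_ball (f x) W by apply/nbhs_ballP/open_nbhs_nbhs.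
have [d d0 fd] := uf _ e0.
suff : nbhs x (evaluation @^-1` B) by [].
rewrite -(@metricType_numDomainType.filter_from_mdist_nbhs R X).
by exists d => //= y /fd fxy; apply/CB/eW.
Qed.

End UniformlyContinuousFunctions.

Section BourbakiCompleteness.
Variables (R : realType) (X : metricType R).

(* [B_d^m(x0, e)] for [m >= 1]. *)
Definition bourbaki_ball (x0 : X) (m : nat) (e : R) : set X :=
  iter m.-1 (fun B => \bigcup_(x in B) ball x e) (ball x0 e).

(* Nets are indexed by nonempty directed preorders. *)
Definition directed (L : Type) (le : L -> L -> Prop) : Prop :=
  [/\ inhabited L,
      forall a, le a a,
      forall a b c, le a b -> le b c -> le a c &
      forall a b, exists c, le a c /\ le b c].

Definition net_tails (L : Type) (le : L -> L -> Prop) : set_system L :=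
  filter_from [set: L] (fun l0 => [set l | le l0 l]).

Definition bourbaki_cauchy (L : Type) (le : L -> L -> Prop) (u : L -> X) : Prop :=
  forall e : R, 0 < e -> exists (m : nat) (x0 : X), (0 < m)%N /\
    \forall l \near net_tails le, bourbaki_ball x0 m e (u l).

Definition bourbaki_complete : Prop :=
  forall (L : Type) (le : L -> L -> Prop) (u : L -> X),
    directed le -> bourbaki_cauchy le u -> cluster (u @ net_tails le) !=set0.

Definition uniformly_discrete (D : set X) : Prop :=
  exists2 e : R, 0 < e & forall x y, D x -> D y -> x <> y -> e < mdist x y.

End BourbakiCompleteness.

(* The type [T] endowed with the sigma-algebra of all its subsets. *)
Definition powerset_measurable (T : Type) : Type := T.

HB.instance Definition _ (T : pointedType) :=
  Pointed.on (powerset_measurable T).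
HB.instance Definition _ (T : pointedType) :=
  @isMeasurable.Build default_measure_display (powerset_measurable T)
    discrete_measurable discrete_measurable0
    discrete_measurableC discrete_measurableU.

(* [S] is required to be pointed because measurable types are; this excludes
   only the empty set, which carries no nonzero measure. *)
Definition measurable_cardinal (R : realType) (T : Type) (D : set T) : Prop :=
  exists (S : pointedType)
         (mu : {measure set (powerset_measurable S) -> \bar R}),
    [/\ ([set: S] #= D)%card,
        forall A, mu A = 0%E \/ mu A = 1%E,
        exists A, mu A <> 0%E &
        forall s, mu [set s] = 0%E].

(* Main.v *)
From HB Require Import structures.
Require Import Defs.
From mathcomp Require Import all_boot all_order all_algebra.
From mathcomp Require Import all_classical all_reals all_analysis.
From mathcomp Require Import lra.
Set Implicit Arguments.
Unset Strict Implicit.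
Unset Printing Implicit Defensive.
Import Order.TTheory GRing.Theory Num.Theory.
Import numFieldNormedType.Exports.
Local Open Scope classical_set_scope.
Local Open Scope ring_scope.

(** Points of the Samuel realcompactification are, on the one hand, limits along
    ultrafilters such that every uniformly continuous function is bounded on one of
    their sets and, on the other hand, homomorphisms [phi], each of which determines
    a filter on [X] along which every [f] tends to [phi f] ([hom_filter_cvg]). The
    first description serves to prove necessity and the second sufficiency.

    Necessity rests on [samuel_realcompact_ultra_cvg]: in a Samuel realcompact space
    an ultrafilter converges as soon as every uniformly continuous function is
    bounded on one of its sets. This applies to an ultrafilter finer than a
    Bourbaki-Cauchy net, since a uniformly continuous function is bounded on
    Bourbaki balls of a suitable radius, and its limit is a cluster point of the net.
    It also applies to the ultrafilter of the sets of full measure for a two-valued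
    measure on a uniformly discrete subspace; there, convergence forces a point of
    positive mass. By [measurable_cardinalP] such measures and countably complete
    free ultrafilters are the same thing.

    For sufficiency, let [phi] be a homomorphism. It is enough to find a cluster
    point [x] of its filter, because then [phi] is evaluation at [x]
    ([hom_filter_cluster]); by Bourbaki-completeness it is enough that for each [e]
    the filter contains a Bourbaki ball of radius [e]
    ([hom_filter_bourbaki_cauchy]). Split [X] into its [e]-chainable components. The
    set of components is uniformly discrete, and [phi] restricted to functions
    constant on components is a two-valued measure on it, so non-measurability
    selects one component. Inside it, the length of the shortest [e]-chain from a
    base point is within [1] of a uniformly continuous function
    ([coarse_ucont_approx]), whose image under [phi] is a real number; hence the
    length is bounded on a set of the filter. *)

(** * Measurable cardinals and ultrafilters *)

(** A bound for every function into the naturals amounts to closure under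
    countable intersections (see [sigma_ultrafilter_bigcup]), and it is the form
    in which countable completeness meets the values of uniformly continuous
    functions. *)
Definition sigma_ultrafilter (T : Type) (G : set_system T) :=
  UltraFilter G /\
  forall f : T -> nat, exists M, G [set x | (f x <= M)%N].

Lemma setVsetC_ultra (T : Type) (G : set_system T) :
  ProperFilter G -> (forall A, G A \/ G (~` A)) -> UltraFilter G.
Proof.
move=> PG GVC; split=> // H PH GH; rewrite eqEsubset; split=> // A HA.
have [//|/GH HCA] := GVC A.
by have [x []] := filter_ex (filterI HA HCA).
Qed.

Lemma sigma_ultrafilter_image (T U : Type) (f : T -> U) (G : set_system T) :
  sigma_ultrafilter G -> sigma_ultrafilter (f @ G).
Proof.
move=> [UG sG]; split=> [|g]; last exact: (sG (g \o f)).
by apply: setVsetC_ultra => A; exact: (in_ultra_setVsetC (f @^-1` A)).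
Qed.

(** Send a point of the union to the first index [n] with [F n x]. This function
    is bounded on a set of [G], so finitely many of the [F n] already cover a set
    of [G], and an ultrafilter contains a member of each finite cover. *)
Lemma sigma_ultrafilter_bigcup (T : Type) (G : set_system T) (F : nat -> set T) :
  sigma_ultrafilter G -> G (\bigcup_n F n) -> exists n, G (F n).
Proof.
move=> [UG sG] GF; apply: contrapT => /forallNP nG.
(* Off the union the value [0] is arbitrary: only points of the union count. *)
pose f x := if pselect (exists n, F n x) is left e
  then ex_minn (let: ex_intro n p := e in ex_intro _ n (asboolT p)) else 0%N.
have [M GM] := sG f.
have GC n : G [set x | forall i, (i < n)%N -> ~ F i x].
  elim: n => [|n IH]; first exact: filterS filterT.
  have [/nG//|GnF] := in_ultra_setVsetC (F n) UG.
  apply: filterS2 IH GnF => x Fx nFnx i; rewrite ltnS leq_eqVlt => /predU1P[->//|].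
  exact: Fx.
have [x [[[n _ Fnx] fxM] Cx]] := filter_ex (filterI (filterI GF GM) (GC M.+1)).
move: fxM; rewrite /f /=; case: pselect => [e|]; last by move=> []; exists n.
by case: ex_minnP => m /asboolP Fmx _ mM; exact: Cx Fmx.
Qed.

Section MeasureOfUltrafilter.
Context {R : realType} {T : pointedType} (G : set_system T).

Definition ultrafilter_mass (A : set (powerset_measurable T)) : \bar R :=
  (`[< G A >]%:R)%:E.

Hypothesis sG : sigma_ultrafilter G.

#[local] Instance sigma_ultrafilter_proper : ProperFilter G.
Proof. by case: sG => [[]]. Qed.

Let mu0 : ultrafilter_mass set0 = 0%E.
Proof. by rewrite /ultrafilter_mass asboolF//; apply: filter_not_empty. Qed.

Let mu_ge0 A : (0 <= ultrafilter_mass A)%E.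
Proof. by rewrite lee_fin ler0n. Qed.

Let mu_semi_sigma_additive : semi_sigma_additive ultrafilter_mass.
Proof.
move=> F _ /trivIsetP tF _; apply: cvg_near_cst.
(* Disjointness leaves room for at most one [F k] in [G], so that the partial
   sums are eventually constant. *)
have [GF|nGF] := pselect (G (\bigcup_n F n)); last first.
  apply: nearW => n; rewrite big1 /ultrafilter_mass ?asboolF// => i _.
  by rewrite asboolF// => GFi; apply: nGF; apply: filterS GFi; exact: bigcup_sup.
have [k GFk] := sigma_ultrafilter_bigcup sG GF.
exists k.+1 => // n /= kn.
rewrite (bigD1_seq k) ?iota_uniq ?mem_index_iota//= big1 => [|i ik].
  by rewrite /ultrafilter_mass !asboolT// adde0.
rewrite /ultrafilter_mass asboolF// => GFi.
have : G (F i `&` F k) by exact: (@filterI T).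
by rewrite tF//; exact: (@filter_not_empty T).
Qed.

HB.instance Definition _ := isMeasure.Build _ _ _ ultrafilter_mass
  mu0 mu_ge0 mu_semi_sigma_additive.

Definition ultrafilter_measure :
  {measure set (powerset_measurable T) -> \bar R} := ultrafilter_mass.

End MeasureOfUltrafilter.

Section UltrafilterOfMeasure.
Context {R : realType} {S : pointedType}.
Variable mu : {measure set (powerset_measurable S) -> \bar R}.
Hypothesis mu01 : forall A, mu A = 0%E \/ mu A = 1%E.
Hypothesis mu_neq0 : exists A, mu A <> 0%E.

Let mA (A : set (powerset_measurable S)) : measurable A. Proof. by []. Qed.

Let le_mu (A B : set S) : A `<=` B -> mu B = 0%E -> mu A = 0%E.
Proof.
move=> AB B0; apply/eqP; rewrite -measure_le0 -B0.
by apply: le_measure => //; rewrite inE.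
Qed.

Let muU (A B : set S) :
  A `&` B = set0 -> mu (A `|` B) = (mu A + mu B)%E.
Proof. move=> AB; exact: (measureU mu (mA A) (mA B) AB). Qed.

(** The sublevel sets of a function into the naturals increase to the whole space.
    By continuity from below they cannot all be null, hence one of them has mass
    one. *)
Lemma measure_sigma_ultrafilter : sigma_ultrafilter [set A : set S | mu A = 1%E].
Proof.
have neq01 : (0%E : \bar R) <> 1%E by move/eqP; rewrite eqe eq_sym oner_eq0.
have muT : mu setT = 1%E.
  have [A muA] := mu_neq0; have [/(le_mu (@subsetT _ A))|//] := mu01 setT.
  by [].
have mu1 (A B : set S) : A `<=` B -> mu A = 1%E -> mu B = 1%E.
  by move=> AB A1; have [/(le_mu AB)|//] := mu01 B; rewrite A1 => /esym/neq01.
have muC (A : set S) : mu A = 0%E -> mu (~` A) = 1%E.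
  move=> A0; rewrite -muT -[in RHS](setUv A) muU//; last exact: setICr.
  by rewrite A0 add0e.
have muI (A B : set S) : mu A = 1%E -> mu B = 1%E -> mu (A `&` B) = 1%E.
  move=> A1 B1; have [AB0|//] := mu01 (A `&` B).
  (* Otherwise [A `\` B] and [B] would be disjoint sets of mass one, and their
     union would have mass two. *)
  have AB1 : mu (A `\` B) = 1%E.
    rewrite -A1 -[in RHS](setUIDK A B) muU//; last first.
      by apply/seteqP; split=> x // -[[_ Bx] [_ /(_ Bx)]].
    by rewrite AB0 add0e.
  have mu2 : mu (A `\` B `|` B) = (2%:R : R)%:E.
    by rewrite muU ?setDKI// AB1 B1 -EFinD.
  by have := mu01 (A `\` B `|` B); rewrite mu2 => -[] /eqP;
    rewrite eqe ?pnatr_eq0// (eqr_nat _ 2 1).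
split.
  apply: setVsetC_ultra; last first.
    by move=> A; have [/muC|] := mu01 A; [right|left].
  apply: Build_ProperFilter_ex => [A A1|].
    apply: contrapT => /forallNP A0.
    by apply: neq01; rewrite -A1 -(measure0 mu); congr (mu _);
      apply/seteqP; split=> x // /A0.
  by split=> // A B AB; exact: mu1.
move=> f; apply: contrapT => /forallNP nf.
have Tf : \bigcup_n [set x | (f x <= n)%N] = setT.
  by rewrite predeqE => x; split=> // _; exists (f x) => /=.
have : mu [set x | (f x <= n)%N] @[n --> \oo] --> 1%E.
  rewrite -muT -Tf; apply: nondecreasing_cvg_mu => // n m nm.
  by apply/subsetPset => x /= /leq_trans; apply.
have -> : (fun n => mu [set x | (f x <= n)%N]) = cst 0%E.
  by apply/funext => n; have [|/nf] := mu01 [set x | (f x <= n)%N].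
by move=> /(cvg_lim (@ereal_hausdorff R)); rewrite lim_cst.
Qed.

End UltrafilterOfMeasure.

(** Measures on an equipotent type are traded for ultrafilters on the ambient type
    [T], to which the structure of [T], such as a metric, applies directly: push
    the measure forward along a bijection onto [D], or transport the ultrafilter to
    the subtype [D]. *)
Lemma measurable_cardinalP (R : realType) (T : choiceType) (D : set T) :
  measurable_cardinal R D <->
  exists G : set_system T,
    [/\ sigma_ultrafilter G, G D & forall x, ~ G [set x]].
Proof.
split=> [[S [mu [/card_bijP[f /bij_inj fI] mu01 mu_neq0 mu_pt]]]|[G [sG GD nGx]]].
  pose g (s : S) : T := set_val (f (SigSub (mem_setT s))).
  have gI : injective g by move=> s t /val_inj/fI [].
  have sM := measure_sigma_ultrafilter mu01 mu_neq0.
  pose M : set_system S := [set A | mu A = 1%E].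
  have UM : UltraFilter M := sM.1.
  exists (g @ M); split.
  - exact: sigma_ultrafilter_image.
  - have -> : (g @ M) D = M (g @^-1` D) by [].
    by apply: filterS filterT => s _; exact: set_valP.
  - move=> x /= gx.
    have [s gs] : (g @^-1` [set x]) !=set0 by exact: (@filter_ex _ M).
    have : mu [set s] = 1%E.
      rewrite -[RHS]gx; congr (mu _); apply/seteqP; split=> t /= [].
        by move=> ->.
      by rewrite -gs => /gI.
    by rewrite mu_pt => /esym/eqP; rewrite eqe oner_eq0.
have [x0 Dx0] : D !=set0 by case: sG => UG _; exact: filter_ex GD.
pose S : pointedType := HB.pack (set_type D)
  (isPointed.Build (set_type D) (SigSub (mem_set Dx0))).
(* The values of [h] off [D] do not matter, since [G] contains [D]. *)
pose h (x : T) : S := insubd (SigSub (mem_set Dx0)) x.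
have UG := sG.1.
have sH := sigma_ultrafilter_image h sG.
exists S, (@ultrafilter_measure R S _ sH); split.
- exact: card_setT.
- move=> A; rewrite /= /ultrafilter_mass.
  by case: `[< _ >]; [right|left].
- exists setT; rewrite /= /ultrafilter_mass asboolT; last first.
    exact: (@filterT _ G).
  by move/eqP; rewrite eqe oner_eq0.
- move=> s; rewrite /= /ultrafilter_mass asboolF// => hs.
  have Gs : G (h @^-1` [set s]) := hs.
  apply: (nGx (set_val s)).
  apply: filterS (filterI GD Gs) => x [Dx /= <-].
  exact/esym/(@insubdK _ _ (set_type D))/mem_set.
Qed.

(** * Limits of functions along ultrafilters *)
Section UltrafilterLimits.
Context {R : realType} {X : metricType R}.

Lemma ultra_bounded_cvg (T : Type) (G : set_system T) (f : T -> R) (M : R) :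
  UltraFilter G -> G [set x | `|f x| <= M] -> exists l : R, f @ G --> l.
Proof.
move=> UG GM.
have UfG : UltraFilter (f @ G).
  by apply: setVsetC_ultra => A; exact: (in_ultra_setVsetC (f @^-1` A)).
have GMM : G (f @^-1` `[- M, M]).
  by apply: filterS GM => x; rewrite /= in_itv/= -ler_norml.
have := @segment_compact R (- M) M; rewrite compact_ultra.
by move=> /(_ _ UfG GMM) [l [_ fl]]; exists l.
Qed.

Lemma metric_cvg (G : set_system X) (x : X) :
  Filter G -> mdist x @ G --> (0 : R) -> G --> x.
Proof.
move=> FG /cvgrPdist_lt xG A.
rewrite -(@metricType_numDomainType.filter_from_mdist_nbhs R X).
move=> [e /= e0 eA]; apply: filterS (xG e e0) => y /=.
by rewrite sub0r normrN => /(le_lt_trans (ler_norm _))/eA.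
Qed.

(** Such an ultrafilter is a point of the Samuel compactification at which no
    uniformly continuous function is infinite. Limits along [G] form a unital
    lattice homomorphism, which is evaluation at some [x]; applied to the distance
    to [x], this says that [G] tends to [x]. *)
Lemma samuel_realcompact_ultra_cvg (G : set_system X) :
  samuel_realcompact X -> UltraFilter G ->
  (forall f : U_d X, exists M : R, G [set x | `|f x| <= M]) ->
  exists x : X, G --> x.
Proof.
move=> srX UG Gbnd.
have /choice[phi phiP] : forall f : U_d X, exists l : R, f @ G --> l.
  by move=> f; have [M] := Gbnd f; exact: ultra_bounded_cvg.
have phiE (f : U_d X) (l : R) : f @ G --> l -> phi f = l.
  by move=> fl; apply: cvg_unique (phiP f) fl; exact: norm_hausdorff.
have phi_hom : unital_vlattice_hom phi.
  split=> [a f g|f g|f g|]; apply: phiE.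
  - by apply: cvgD; [apply: cvgMl_tmp; exact: phiP | exact: phiP].
  - have -> : U_val (Order.meet f g) = (fun x => Num.min (f x) (g x)).
      by apply/funext => x; rewrite -meetEtotal.
    rewrite meetEtotal.
    exact: (continuous2_cvg _ (@min_continuous _ R (_, _)) (phiP f) (phiP g)).
  - have -> : U_val (Order.join f g) = (fun x => Num.max (f x) (g x)).
      by apply/funext => x; rewrite -joinEtotal.
    rewrite joinEtotal.
    exact: (continuous2_cvg _ (@max_continuous _ R (_, _)) (phiP f) (phiP g)).
  - exact: cvg_cst.
have : samuel_realcompactification (phi : {ptws U_d X -> R}) by [].
rewrite -srX => -[x _ phix]; exists x; apply: metric_cvg.
have := phiP (UFun (ucont_mdist x)); rewrite -phix.
by rewrite /evaluation/= mdistxx.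
Qed.

End UltrafilterLimits.

(** * Bourbaki balls *)
Section BourbakiBalls.
Context {R : realType} {X : metricType R}.
Implicit Types (x y z : X) (e : R) (m n : nat).

Lemma bourbaki_ball1 x e : bourbaki_ball x 1 e = [set y | mdist x y < e].
Proof. by rewrite /bourbaki_ball/= ballEmdist. Qed.

Lemma bourbaki_ballS x m e z : bourbaki_ball x m.+2 e z <->
  exists2 y, bourbaki_ball x m.+1 e y & mdist y z < e.
Proof. by split=> -[y xy yz]; exists y => //; move: yz; rewrite ballEmdist. Qed.

Lemma bourbaki_ball_center x m e : 0 < e -> bourbaki_ball x m.+1 e x.
Proof.
move=> e0; elim: m => [|m IH]; first by rewrite bourbaki_ball1/= mdistxx.
by apply/bourbaki_ballS; exists x; rewrite ?mdistxx.
Qed.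

Lemma bourbaki_ballW x m n e : 0 < e -> (m <= n)%N ->
  bourbaki_ball x m.+1 e `<=` bourbaki_ball x n.+1 e.
Proof.
move=> e0 /subnK <-; elim: (n - m)%N => // k IH y /IH xy.
by rewrite addSn; apply/bourbaki_ballS; exists y; rewrite ?mdistxx.
Qed.

Lemma bourbaki_ball_trans x y z m n e :
  bourbaki_ball x m.+1 e y -> bourbaki_ball y n.+1 e z ->
  bourbaki_ball x (m + n).+2 e z.
Proof.
move=> xy; elim: n z => [|n IH] z.
  by rewrite addn0 bourbaki_ball1/= => yz; apply/bourbaki_ballS; exists y.
move=> /bourbaki_ballS[t /IH xt tz]; rewrite addnS.
by apply/bourbaki_ballS; exists t.
Qed.

Lemma bourbaki_ball_sym x y m e :
  bourbaki_ball x m.+1 e y -> bourbaki_ball y m.+1 e x.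
Proof.
elim: m y => [|m IH] y; first by rewrite !bourbaki_ball1/= metric_sym.
move=> /bourbaki_ballS[t /IH tx ty].
apply: (@bourbaki_ball_trans _ t _ 0) tx.
by rewrite bourbaki_ball1/= metric_sym.
Qed.

(** This is why Bourbaki-Cauchy nets matter here: along each link of a chain [f]
    moves by less than [1], so the length of the chain bounds its variation. *)
Lemma ucont_bounded_bourbaki_ball (f : X -> R) x m e :
  (forall y z, mdist y z < e -> `|f y - f z| < 1) ->
  forall y, bourbaki_ball x m.+1 e y -> `|f y - f x| <= m.+1%:R.
Proof.
move=> fe; elim: m => [|m IH] y.
  by rewrite bourbaki_ball1/= metric_sym => /fe/ltW.
move=> /bourbaki_ballS[t /IH ft]; rewrite metric_sym => /fe/ltW yt.
by rewrite -(subrKA (f t)) -natr1 addrC (le_trans (ler_normD _ _))// lerD.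
Qed.

(** The filter is presented as the net of the pairs [(A, y)] with [y \in A] and [A]
    in the filter, ordered by reverse inclusion of the first components; its tails
    have the sets [A] as images. *)
Lemma bourbaki_complete_cluster (F : set_system X) :
  bourbaki_complete X -> ProperFilter F ->
  (forall e, 0 < e -> exists m x, F (bourbaki_ball x m.+1 e)) ->
  cluster F !=set0.
Proof.
move=> bX PF FB.
pose L := {p : set X * X | F p.1 /\ p.1 p.2}.
pose le (p q : L) := (sval q).1 `<=` (sval p).1.
pose u (p : L) := (sval p).2.
have FL A : F A -> exists p : L, (sval p).1 = A.
  by move=> FA; have [x Ax] := filter_ex FA; exists (exist _ (A, x) (conj FA Ax)).
have dir : directed le.
  split=> [|p|p q r pq qr|p q].
  - by have [p _] := FL setT filterT; constructor.
  - exact: subset_refl.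
  - exact: subset_trans qr pq.
  - have [r rE] := FL _ (filterI (svalP p).1 (svalP q).1).
    by exists r; rewrite /le rE; split=> [x []|x []].
have bcu : bourbaki_cauchy le u.
  move=> e /FB[m [x0 FA]]; exists m.+1, x0; split=> //.
  have [p pA] := FL _ FA; exists p => //= q; rewrite /le pA; apply.
  exact: (svalP q).2.
have [x clx] := bX L le u dir bcu; exists x => A B FA xB.
apply: clx xB; have [p pA] := FL _ FA; exists p => //= q.
by rewrite /le pA; apply; exact: (svalP q).2.
Qed.

End BourbakiBalls.

(** * Samuel realcompactness implies both conditions *)
Section SamuelRealcompactNecessary.
Context {R : realType} {X : metricType R}.

Lemma samuel_realcompact_bourbaki_complete :
  samuel_realcompact X -> bourbaki_complete X.
Proof.
move=> srX L le u [[l0] lexx letrans ledir] bcu.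
have Ptails : ProperFilter (net_tails le).
  apply: filter_from_proper; last by move=> l _; exists l; exact: lexx.
  apply: filter_from_filter; first by exists l0.
  move=> a b _ _; have [c [ac bc]] := ledir a b; exists c => // d cd.
  by split; [exact: letrans ac cd | exact: letrans bc cd].
have [G [UG uG]] := ultraFilterLemma (fmap_proper_filter u Ptails).
have [f|x Gx] := samuel_realcompact_ultra_cvg srX UG; last first.
  exists x => A B uA xB; exact: (filter_ex (filterI (uG _ uA) (Gx _ xB))).
have /ucontP/(_ 1 ltr01)[e e0 fe] := valP f.
have [[|m] [x0 [m0 ub]]] := bcu e e0; first by [].
(* [e] is a modulus of uniform continuity of [f] for the bound [1]. *)
exists (`|f x0| + m.+1%:R); apply: filterS (uG _ ub) => y /=.
move=> /(ucont_bounded_bourbaki_ball fe).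
by have := ler_normB (f y - f x0) (- f x0); rewrite opprK subrK normrN; lra.
Qed.

(** A countably complete ultrafilter bounds every real function on one of its
    sets, so it converges. Small balls around its limit meet a uniformly discrete
    set in at most one point, hence the ultrafilter is principal. *)
Lemma samuel_realcompact_uniformly_discrete (D : set X) :
  samuel_realcompact X -> uniformly_discrete D -> ~ measurable_cardinal R D.
Proof.
move=> srX [e e0 De] /measurable_cardinalP[G [[UG sG] GD nG]].
have [f|x Gx] := samuel_realcompact_ultra_cvg srX UG.
  have [M GM] := sG (fun x => Num.trunc `|f x|).
  by exists M.+1%:R; apply: filterS GM => x /=; rewrite truncn_le_nat => /ltW.
have GB : G [set y | mdist x y < e / 2].
  apply: Gx; rewrite -(@metricType_numDomainType.filter_from_mdist_nbhs R X).
  by exists (e / 2); rewrite //= divr_gt0.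
have [y [Dy xy]] := filter_ex (filterI GD GB).
apply: (nG y); apply: filterS (filterI GD GB) => z [Dz /= xz].
apply: contrapT => zy; have := De _ _ Dz Dy zy.
have := metric_triangle z x y; rewrite (metric_sym z x) /= in xy *; lra.
Qed.

End SamuelRealcompactNecessary.

(** * Uniformly continuous approximation of coarse functions *)
Section Smoothing.
Context {R : realType} {X : metricType R}.

(** A function whose jumps at scale [e] are at most [1] need not be continuous, but
    its inf-convolution [h x = inf (N y + mdist x y / e)] over the [y] at distance
    less than [e] from [x] is, with a local Lipschitz constant [2 / e]. Restricting
    the infimum to nearby [y] keeps [h] within [1] of [N]. *)
Lemma coarse_ucont_approx (e : R) (N : X -> R) : 0 < e ->
  (forall x, 0 <= N x) ->
  (forall x y, mdist x y < e -> N x <= N y + 1) ->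
  exists2 h : X -> R, h \in @ucont R X & forall x, N x - 1 <= h x <= N x.
Proof.
move=> e0 N0 Ne.
pose cost x y := N y + mdist x y / e.
pose E x := [set cost x y | y in [set y | mdist x y < e]].
have Elb x : has_lbound (E x).
  by exists 0 => _ [y _ <-]; rewrite addr_ge0// divr_ge0 ?mdist_ge0// ltW.
have ENx x : E x (N x).
  by exists x => /=; rewrite ?/cost mdistxx ?mul0r ?addr0.
have E0 x : E x !=set0 by exists (N x).
pose h x := inf (E x).
have hN x : h x <= N x by exact: ge_inf.
have hlip x y : mdist x y < e -> h y <= h x + 2 * (mdist x y / e).
  move=> xy; rewrite -lerBlDr; apply: lb_le_inf => // _ [z /= xz <-].
  rewrite lerBlDr /cost.
  have xy0 : 0 <= mdist x y / e by rewrite divr_ge0 ?mdist_ge0// ltW.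
  have [yz|zy] := ltP (mdist y z) e.
    have : h y <= cost y z by apply: ge_inf => //; exists z.
    have : mdist y z / e <= mdist x y / e + mdist x z / e.
      rewrite -mulrDl ler_pM2r ?invr_gt0//.
      by rewrite (metric_sym x y) metric_triangle.
    by rewrite /cost; lra.
  (* Here [z] is not an admissible competitor for [y]. Then [x] serves instead,
     because the points [x], [z] are almost [e] apart: the distance term in
     [cost x z] nearly pays for a unit jump of [N]. *)
  have : h y <= cost y x by apply: ge_inf => //; exists x; rewrite //= metric_sym.
  have : 1 <= mdist x y / e + mdist x z / e.
    rewrite -mulrDl ler_pdivlMr// mul1r (le_trans zy)//.
    by rewrite (metric_sym x y) metric_triangle.
  by have := Ne _ _ xz; rewrite /cost (metric_sym y x); lra.
exists h => [|x]; last first.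
  rewrite hN andbT; apply: lb_le_inf => // _ [y /= xy <-].
  have := Ne _ _ xy; have : 0 <= mdist x y / e by rewrite divr_ge0 ?mdist_ge0// ltW.
  by rewrite /cost; lra.
apply/ucontP => d d0; exists (Num.min e (d / 2 * e)).
  by rewrite lt_min e0 mulr_gt0// divr_gt0.
move=> x y; rewrite lt_min => /andP[xye xyd].
have := hlip _ _ xye; have := hlip y x; rewrite (metric_sym y x) => /(_ xye).
move: xyd; rewrite -ltr_pdivrMr// => xyd ? ?.
by rewrite ltr_norml; apply/andP; split; lra.
Qed.

Lemma locally_constant_ucont (e : R) (f : X -> R) : 0 < e ->
  (forall x y, mdist x y < e -> f x = f y) -> f \in @ucont R X.
Proof.
move=> e0 fe; apply/ucontP => d d0; exists e => // x y /fe ->.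
by rewrite subrr normr0.
Qed.

End Smoothing.

(** * The filter of a homomorphism *)
Section HomFilter.
Context {R : realType} {X : metricType R} (phi : U_d X -> R).

(** The traces on [X] of the neighbourhoods of [phi] in the Samuel
    compactification. Strict sublevel sets at height [1] suffice because the kernel
    of [phi] is stable under scaling, and they intersect well because it is stable
    under joins. *)
Definition hom_filter : set_system X :=
  filter_from [set f : U_d X | phi f = 0] (fun f => [set x | f x < 1]).

Hypothesis phiH : unital_vlattice_hom phi.

Let phi0 : phi 0 = 0.
Proof.
have [phiL _ _ _] := phiH.
by have := phiL (-1) 0 0; rewrite scaler0 addr0 mulN1r; lra.
Qed.

#[local] Instance hom_filter_proper : ProperFilter hom_filter.
Proof.
have [_ phiI phiU phi1] := phiH.
apply: filter_from_proper; last first.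
  move=> f /= f0; apply: contrapT => /forallNP nf.
  (* An empty sublevel set would make [1 <= f], whence [1 <= phi f]. *)
  have f1 : Order.meet f (U_one X) = U_one X.
    apply/val_inj/funext => x.
    have -> : \val (Order.meet f (U_one X)) x = Num.min (f x) 1.
      by rewrite -meetEtotal.
    by rewrite min_r// leNgt; apply/negP; exact: nf.
  have := phiI f (U_one X); rewrite f1 phi1 f0 meetEtotal.
  by rewrite min_l// => /eqP; rewrite oner_eq0.
apply: filter_from_filter; first by exists 0.
move=> f g /= f0 g0; exists (Order.join f g).
  by rewrite phiU f0 g0 joinEtotal maxxx.
move=> x; rewrite /mkset.
have -> : U_val (Order.join f g) x = Num.max (f x) (g x) by rewrite -joinEtotal.
by rewrite gt_max => /andP[].
Qed.

Lemma hom_filter_cvg (f : U_d X) : f @ hom_filter --> phi f.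
Proof.
have [phiL _ _ phi1] := phiH.
apply/cvgrPdist_lt => e e0.
pose g (a : R) := a *: (f + (- phi f) *: U_one X) : U_d X.
have phiD (u v : U_d X) : phi (u + v) = phi u + phi v.
  by rewrite -[u]scale1r phiL mul1r scale1r.
have phiZ a (u : U_d X) : phi (a *: u) = a * phi u.
  by rewrite -[a *: u]addr0 phiL phi0 addr0.
(* The sublevel sets of [g e^-1] and [g (- e^-1)] bound [f - phi f] by [e] from
   above and from below. *)
have g0 a : phi (g a) = 0.
  by rewrite phiZ phiD phiZ phi1 mulr1 subrr mulr0.
have gE a x : g a x = a * (f x - phi f).
  by rewrite /g /= -[in RHS](mulr1 (phi f)) -mulNr.
have Fg a : hom_filter [set x | g a x < 1] by exists (g a).
apply: filterS (filterI (Fg e^-1) (Fg (- e^-1))) => x [].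
rewrite /mkset !gE mulNr -mulrN ![_^-1 * _]mulrC !ltr_pdivrMr// mul1r => ? ?.
by rewrite ltr_norml; apply/andP; split; lra.
Qed.

(** The values converge along the filter, and the integers are discrete. *)
Lemma hom_filter_eventually_constant (f : X -> nat) :
  (fun x => (f x)%:R) \in @ucont R X -> exists k, hom_filter [set x | f x = k].
Proof.
move=> fu; have /cvgrPdist_lt/(_ (1 / 2)) := @hom_filter_cvg (UFun fu).
rewrite divr_gt0// => /(_ isT) /= fF.
have [x fx] := filter_ex fF.
exists (f x); apply: filterS fF => y; move: fx => /= fx fy.
have : `|(f y)%:R - (f x)%:R : R| < 1.
  move: fx fy; rewrite !ltr_norml => /andP[? ?] /andP[? ?].
  by apply/andP; split; lra.
rewrite ltr_norml => /andP[yx xy].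
have : (f y < (f x).+1)%N by rewrite -(ltr_nat R) -natr1; lra.
have : (f x < (f y).+1)%N by rewrite -(ltr_nat R) -natr1; lra.
by rewrite !ltnS => ? ?; apply/eqP; rewrite eqn_leq; apply/andP.
Qed.

Lemma hom_filter_cluster (x : X) : cluster hom_filter x -> phi = evaluation x.
Proof.
move=> clx; apply/funext => f; apply/eqP; rewrite -subr_eq0 -normr_eq0.
rewrite eq_le normr_ge0 andbT; apply/ler_addgt0Pl => e e0; rewrite addr0.
have /ucontP/(_ (e / 2)) := valP f; rewrite divr_gt0// => -[//|d d0 fd].
have {}fd a b : mdist a b < d -> `|f a - f b| < e / 2 by exact: fd.
have /cvgrPdist_lt/(_ (e / 2)) := @hom_filter_cvg f.
rewrite divr_gt0// => /(_ isT) fF.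
have xB : nbhs x [set y | mdist x y < d].
  by rewrite -(@metricType_numDomainType.filter_from_mdist_nbhs R X); exists d.
have [y [/= fy /fd xy]] := clx _ _ fF xB.
move: fy xy; rewrite /evaluation ler_norml !ltr_norml => /andP[? ?] /andP[? ?].
by apply/andP; split; lra.
Qed.

End HomFilter.

(** * Both conditions imply Samuel realcompactness *)
Section SamuelRealcompactSufficient.
Context {R : realType} {X : metricType R}.

(** The heart of the theorem. Points joined by chains with steps less than [e] form
    components that lie at distance at least [e] from one another, so that a system
    of representatives is uniformly discrete and every function factoring through
    the component map is uniformly continuous. The image of the filter on the
    representatives is therefore a countably complete ultrafilter, and it is
    principal when their cardinal is non-measurable: one single component [C]
    belongs to the filter. The number of steps needed to reach a point from the
    representative is a coarse function, so its smoothing is bounded on a set of the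
    filter, whose intersection with [C] lies in a Bourbaki ball. *)
Lemma hom_filter_bourbaki_cauchy (phi : U_d X -> R) (e : R) :
  (forall D : set X, uniformly_discrete D -> ~ measurable_cardinal R D) ->
  unital_vlattice_hom phi -> 0 < e ->
  exists m x, hom_filter phi (bourbaki_ball x m.+1 e).
Proof.
move=> nmc phiH e0.
pose F := hom_filter phi; have PF : ProperFilter F := hom_filter_proper phiH.
have [x0 _] := filter_ex (@filterT _ F _).
pose comp (x : X) := [set y | exists m, bourbaki_ball x m.+1 e y].
have comp_sub x y : comp x y -> comp y `<=` comp x.
  by move=> [m xy] z [n yz]; exists (m + n).+1; exact: bourbaki_ball_trans xy yz.
have comp_sym x y : comp x y -> comp y x.
  by move=> [m xy]; exists m; exact: bourbaki_ball_sym.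
have comp_eq x y : comp x y -> comp x = comp y.
  by move=> xy; apply/seteqP; split; apply: comp_sub => //; exact: comp_sym.
have comp_near x y : mdist x y < e -> comp x y.
  by move=> xy; exists 0%N; rewrite bourbaki_ball1.
have compxx x : comp x x by exists 0%N; exact: bourbaki_ball_center.
(* Choosing from the set [comp x], equal for all the points of a component, makes
   the representative depend on the component alone. *)
pose rep (x : X) := xget x0 (comp x).
have rep_comp x : comp (rep x) x.
  by apply: comp_sym; apply: (@xgetPex _ x0 (comp x)); exists x.
have rep_near x y : mdist x y < e -> rep x = rep y.
  by move=> /comp_near/comp_eq; rewrite /rep => ->.
have rep_ud : uniformly_discrete (range rep).
  exists (e / 2) => [|_ _ [x _ <-] [y _ <-] xy]; first exact: divr_gt0.
  rewrite ltNge; apply/negP => xye; apply: xy.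
  have repE z : comp z = comp (rep z) by rewrite (comp_eq _ _ (rep_comp z)).
  rewrite /rep (repE x) (repE y); congr xget; apply/comp_eq/comp_near.
  by rewrite (le_lt_trans xye)// ltr_pdivrMr// ltr_pMr// ltr1n.
have rep_cst (f : X -> nat) : exists k, F [set x | f (rep x) = k].
  apply: hom_filter_eventually_constant phiH _ _.
  by apply: (locally_constant_ucont e0) => x y /rep_near ->.
have sG : sigma_ultrafilter (rep @ F).
  split.
    apply: setVsetC_ultra => A.
    (* The indicator function of [A] on the components is eventually constant. *)
    have [k Fk] := rep_cst (fun x => `[< A x >] : nat).
    have [x /= xk] := filter_ex Fk.
    have [Ax|nAx] := pselect (A (rep x)).
      left; apply: filterS Fk => y /=; rewrite -xk (asboolT Ax).
      by case: (@asboolP (A (rep y))).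
    right; apply: filterS Fk => y /=; rewrite -xk (asboolF nAx).
    by case: (@asboolP (A (rep y))).
  move=> f; have [k Fk] := rep_cst f; exists k.
  by apply: filterS Fk => x /= ->.
have [x1 Fx1] : exists x1, F [set x | rep x = x1].
  apply: contrapT => /forallNP nF; apply: (nmc _ rep_ud).
  apply/measurable_cardinalP; exists (rep @ F); split => //.
  have : F (rep @^-1` range rep) by apply: filterS filterT => x _; exists x.
  by [].
have chain x : exists m, `[< bourbaki_ball (rep x) m.+1 e x >].
  by have [m xm] := rep_comp x; exists m; exact/asboolP.
pose N (x : X) := ex_minn (chain x).
have NP x : bourbaki_ball (rep x) (N x).+1 e x.
  by rewrite /N; case: ex_minnP => m /asboolP.
have Nle x m : bourbaki_ball (rep x) m.+1 e x -> (N x <= m)%N.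
  by move=> xm; rewrite /N; case: ex_minnP => n _; apply; exact/asboolP.
have Nnear x y : mdist x y < e -> (N x)%:R <= (N y)%:R + 1 :> R.
  move=> xy; rewrite natr1 ler_nat; apply: Nle; apply/bourbaki_ballS.
  exists y; last by rewrite metric_sym.
  by rewrite (rep_near _ _ xy); exact: NP.
have [h hu hN] := coarse_ucont_approx e0 (fun x => ler0n R (N x)) Nnear.
have /cvgrPdist_lt/(_ 1 ltr01) Fh := @hom_filter_cvg _ _ phi phiH (UFun hu).
(* Eventually [N <= h + 1 < phi h + 2 < M + 1]. *)
pose M := Num.trunc (phi (UFun hu) + 2).
exists M, x1; apply: filterS (filterI Fx1 Fh) => x [/= <-].
rewrite ltr_norml => /andP[hx _].
apply: (bourbaki_ballW e0 _ (NP x)).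
rewrite -ltnS -(ltr_nat R) (le_lt_trans _ (truncnS_gt _))//.
by have /andP[] := hN x; lra.
Qed.

End SamuelRealcompactSufficient.

Theorem theorem28 (R : realType) (X : metricType R) :
  samuel_realcompact X <->
  bourbaki_complete X /\
  (forall D : set X, uniformly_discrete D -> ~ measurable_cardinal R D).
Proof.
split=> [srX|[bX nmc]].
  split; first exact: samuel_realcompact_bourbaki_complete.
  by move=> D; exact: samuel_realcompact_uniformly_discrete.
apply/seteqP; split=> [_ [x _ <-]|phi phiH]; first exact: evaluation_hom.
have [||x clx] := @bourbaki_complete_cluster _ _ (hom_filter phi) bX.
- exact: hom_filter_proper.
- by move=> e; exact: hom_filter_bourbaki_cauchy.
- by exists x => //; rewrite (hom_filter_cluster phiH clx).
Qed.
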